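(* Let $(M,\mathfrak g,T)$ be an embedding tensor on a Malcev algebra, let $(V,W,T')$ be an abelian embedding tensor, and let $(\rho_1,\rho_2,\rho_3)$ be a fixed representation of $(M,\mathfrak g,T)$ on $(V,W,T')$. Then there is a one-to-one correspondence between equivalence classes of abelian extensions of $(M,\mathfrak g,T)$ by $(V,W,T')$ inducing the representation $(\rho_1,\rho_2,\rho_3)$ and elements of the second cohomology group $\mathbf H^2((M,\mathfrak g,T),(V,W,T'))$ (2-cocycles modulo 2-coboundaries).
   Context: All vector spaces and linear maps are over a fixed field of characteristic $0$. A Malcev algebra is a vector space $\mathfrak g$ with a skew-symmetric bilinear bracket satisfying $J(x,y,[x,z])=[J(x,y,z),x]$ for all $x,y,z$, where $J(x,y,z)=[[x,y],z]+[[y,z],x]+[[z,x],y]$; equivalently $[[x,z],[y,t]]=[[[x,y],z],t]+[[[y,z],t],x]+[[[z,t],x],y]+[[[t,x],y],z]$. A representation of $\mathfrak g$ on a vector space $M$ is a linear map $\rho:\mathfrak g\to\operatorname{End}(M)$ with $\rho([[x,y],z])=\rho(x)\rho(y)\rho(z)-\rho(z)\rho(x)\rho(y)+\rho(y)\rho([z,x])-\rho([y,z])\rho(x)$. An embedding tensor $(M,\mathfrak g,T)$ consists of a Malcev algebra $\mathfrak g$, a representation $(M,\rho)$ of $\mathfrak g$, and a linear map $T:M\to\mathfrak g$ with $[T(m),T(n)]=T(\rho(T(m))(n))$ for all $m,n\in M$. A morphism $(F_0,F_1):(M,\mathfrak g,T)\to(M',\mathfrak g',T')$ of embedding tensors is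 a pair of linear maps $F_0:M\to M'$, $F_1:\mathfrak g\to\mathfrak g'$ with $T'F_0=F_1T$, $F_1([x,y])=[F_1(x),F_1(y)]$ and $F_0(\rho(x)(m))=\rho'(F_1(x))(F_0(m))$. $(V,W,T')$ is abelian if the bracket of $W$ is zero, the bracket of $V$ is zero, and the representation of $W$ on $V$ is zero (so the data is just a linear map $T':V\to W$). Representation. $(\rho_1,\rho_2,\rho_3)$ is a representation of $(M,\mathfrak g,T)$ on $(V,W,T')$ if, for all $x,y\in\mathfrak g$, $m\in M$, $v\in V$, $w\in W$: (i) $\rho_1,\rho_2$ are representations of the Malcev algebra $\mathfrak g$ on $V$, $W$ respectively; (ii) $T'(\rho_1(x)(v))=\rho_2(x)(T'(v))$; (iii) $\rho_3:M\to\operatorname{Hom}(W,V)$ is linear with $\rho_2(T(m))(T'(v))=T'(\rho_3(m)(T'(v)))$; (iv) $$\rho_3(m)\rho_2(x)\rho_2(y)(w)-\rho_1(x)\rho_1(y)\rho_3(m)(w)+\rho_1(y)\rho_3(\rho(x)(m))(w)+\rho_3(\rho(y)(m))\rho_2(x)(w)+\rho_3(\rho([x,y])(m))(w)=0,$$ $$\rho_3(m)\rho_2([x,y])(w)-\rho_1(x)\rho_1(y)\rho_3(m)(w)+\rho_3(\rho(x)\rho(y)(m))(w)+\rho_1(y)\rho_3(m)\rho_2(x)(w)+\rho_3(\rho(x)(m))\rho_2(y)(w)=0,$$ $$\rho_3(m)\rho_2(x)\rho_2(y)(w)-\rho_3(\rho(y)\rho(x)(m))(w)+\rho_1(x)\rho_3(\rho(y)(m))(w)-\rho_1(y)\rho_3(m)\rho_2(x)(w)+\rho_1([y,x])\rho_3(m)(w)=0.$$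 Abelian extensions. An abelian extension of $(M,\mathfrak g,T)$ by an abelian $(V,W,T')$ is an embedding tensor $(\widehat M,\widehat{\mathfrak g},\widehat T)$, with action $\widehat\rho$, and morphisms $i=(i_0,i_1):(V,W,T')\to(\widehat M,\widehat{\mathfrak g},\widehat T)$, $p=(p_0,p_1):(\widehat M,\widehat{\mathfrak g},\widehat T)\to(M,\mathfrak g,T)$ such that $0\to V\to\widehat M\to M\to0$ and $0\to W\to\widehat{\mathfrak g}\to\mathfrak g\to0$ are exact. Two extensions (with maps $i,p$ and $j,q$) are equivalent if there is a morphism $F$ from the first to the second with $F\circ i=j$ and $q\circ F=p$. The extension induces $(\rho_1,\rho_2,\rho_3)$ if, for linear sections $\sigma_0$ of $p_0$ and $\sigma_1$ of $p_1$ (and with $V\subset\widehat M$, $W\subset\widehat{\mathfrak g}$), $\rho_1(x)(v)=\widehat\rho(\sigma_1(x))(v)$, $\rho_2(x)(w)=[\sigma_1(x),w]$, $\rho_3(m)(w)=-\widehat\rho(w)(\sigma_0(m))$; these maps do not depend on the sections. 2-cocycles. A 2-cocycle is a triple of linear maps $\theta:M\to W$, $\omega:\mathfrak g\wedge\mathfrak g\to W$, $\nu:\mathfrak g\otimes M\to V$ such that for all $x,y,z,t\in\mathfrak g$, $m,n\in M$: (1) $\rho_2(T(m))(\theta(n))-\rho_2(T(n))(\theta(m))+\omega(T(m),T(n))-T'(\nu(T(m),n))-\theta(\rho(T(m))(n))+T'(\rho_3(n)(\theta(m)))=0$; (2) $\rho_2([x,z])\omega(y,t)-\rho_2([y,t])\omega(x,z)+\omega([x,z],[y,t])+\rho_2(t)\omega([x,y],z)+\rho_2(x)\omega([y,z],t)+\rho_2(y)\omega([z,t],x)+\rho_2(z)\omega([t,x],y)-\rho_2(t)\rho_2(z)\omega(x,y)-\rho_2(x)\rho_2(t)\omega(y,z)-\rho_2(y)\rho_2(x)\omega(z,t)-\rho_2(z)\rho_2(y)\omega(t,x)-\omega([[x,y],z],t)-\omega([[y,z],t],x)-\omega([[z,t],x],y)-\omega([[t,x],y],z)=0$;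 (3) $\rho_3(m)(\rho_2(z)\omega(x,y))-\rho_3(m)(\omega([x,y],z))+\nu([[x,y],z],m)-\rho_1(x)\rho_1(y)\nu(z,m)-\rho_1(x)\nu(y,\rho(z)(m))-\nu(x,\rho(y)\rho(z)(m))+\rho_1(z)\rho_1(x)\nu(y,m)+\rho_1(z)\nu(x,\rho(y)(m))+\nu(z,\rho(x)\rho(y)(m))+\rho_1(y)\rho_3(m)(\omega(z,x))-\rho_1(y)\nu([z,x],m)-\nu(y,\rho([z,x])(m))-\rho_3(\rho(x)(m))(\omega(y,z))+\rho_1([y,z])\nu(x,m)+\nu([y,z],\rho(x)(m))=0$. 2-coboundaries. For linear maps $b_0:M\to V$ and $b_1:\mathfrak g\to W$, the 2-coboundary $D(b_0,b_1)$ is the triple with components $$m\mapsto T'(b_0(m))-b_1(T(m)),\quad (x,y)\mapsto\rho_2(x)(b_1(y))-\rho_2(y)(b_1(x))-b_1([x,y]),$$ $$(x,m)\mapsto\rho_1(x)(b_0(m))-\rho_3(m)(b_1(x))-b_0(\rho(x)(m)).$$ $\mathbf H^2((M,\mathfrak g,T),(V,W,T'))$ is the space of 2-cocycles modulo the space of 2-coboundaries. *)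

(* Defs.v *)
From HB Require Import structures.
From mathcomp Require Import all_boot all_order all_algebra.
From mathcomp Require Import boolp classical_sets functions.

Set Implicit Arguments.
Unset Strict Implicit.
Unset Printing Implicit Defensive.

Import GRing.Theory.

Local Open Scope ring_scope.

Definition jacobian (V : zmodType) (b : V -> V -> V) (x y z : V) : V :=
  b (b x y) z + b (b y z) x + b (b z x) y.

Record malcev (K : fieldType) := Malcev {
  malcev_car :> lmodType K;
  malcev_br : {bilinear malcev_car -> malcev_car -> malcev_car};
  malcev_skew : forall x y, malcev_br x y = - malcev_br y x;
  malcev_id : forall x y z,
    jacobian malcev_br x y (malcev_br x z)
    = malcev_br (jacobian malcev_br x y z) x
}.

Notation br := (malcev_br _).

(* A linear map g -> End(M) is encoded as a bilinear map g -> M -> M. *)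
Definition malcev_rep (K : fieldType) (g : malcev K) (M : lmodType K)
    (rho : g -> M -> M) : Prop :=
  forall (x y z : g) (m : M),
    rho (br (br x y) z) m
    = rho x (rho y (rho z m)) - rho z (rho x (rho y m))
      + rho y (rho (br z x) m) - rho (br y z) (rho x m).

Record embTensor (K : fieldType) := EmbTensor {
  et_mod : lmodType K;
  et_alg : malcev K;
  et_rho : {bilinear et_alg -> et_mod -> et_mod};
  et_T : {linear et_mod -> et_alg};
  et_rhoP : malcev_rep et_rho;
  et_TP : forall m n, br (et_T m) (et_T n) = et_T (et_rho (et_T m) n)
}.

Record etMorph (K : fieldType) (E E' : embTensor K) := EtMorph {
  mor0 : {linear et_mod E -> et_mod E'};
  mor1 : {linear et_alg E -> et_alg E'};
  mor_T : forall m, et_T E' (mor0 m) = mor1 (et_T E m);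
  mor_br : forall x y, mor1 (br x y) = br (mor1 x) (mor1 y);
  mor_rho : forall x m, mor0 (et_rho E x m) = et_rho E' (mor1 x) (mor0 m)
}.

(* The only bracket carried by the module of an embedding tensor is the one
   induced by T. *)
Definition et_mod_br (K : fieldType) (E : embTensor K) (m n : et_mod E) :=
  et_rho E (et_T E m) n.

Definition et_abelian (K : fieldType) (A : embTensor K) : Prop :=
  [/\ forall w w' : et_alg A, br w w' = 0,
      forall v v' : et_mod A, et_mod_br v v' = 0
    & forall (w : et_alg A) (v : et_mod A), et_rho A w v = 0].

Section Representation.
Variables (K : fieldType) (E A : embTensor K).
Local Notation M := (et_mod E).
Local Notation g := (et_alg E).
Local Notation rho := (et_rho E).
Local Notation T := (et_T E).
Local Notation V := (et_mod A).
Local Notation W := (et_alg A).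
Local Notation T' := (et_T A).

(* M -> Hom(W, V) is again curried as a bilinear map M -> W -> V. *)
Record etRep := EtRep {
  rho1 : {bilinear g -> V -> V};
  rho2 : {bilinear g -> W -> W};
  rho3 : {bilinear M -> W -> V};
  rho1P : malcev_rep rho1;
  rho2P : malcev_rep rho2;
  rho12T : forall x v, T' (rho1 x v) = rho2 x (T' v);
  rho23T : forall m v, rho2 (T m) (T' v) = T' (rho3 m (T' v));
  rho_compat1 : forall x y m w,
    rho3 m (rho2 x (rho2 y w)) - rho1 x (rho1 y (rho3 m w))
    + rho1 y (rho3 (rho x m) w) + rho3 (rho y m) (rho2 x w)
    + rho3 (rho (br x y) m) w = 0;
  rho_compat2 : forall x y m w,
    rho3 m (rho2 (br x y) w) - rho1 x (rho1 y (rho3 m w))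
    + rho3 (rho x (rho y m)) w + rho1 y (rho3 m (rho2 x w))
    + rho3 (rho x m) (rho2 y w) = 0;
  rho_compat3 : forall x y m w,
    rho3 m (rho2 x (rho2 y w)) - rho3 (rho y (rho x m)) w
    + rho1 x (rho3 (rho y m) w) - rho1 y (rho3 m (rho2 x w))
    + rho1 (br y x) (rho3 m w) = 0
}.

End Representation.

Definition short_exact (U V W : zmodType) (f : U -> V) (h : V -> W) : Prop :=
  [/\ injective f,
      forall v, h v = 0 <-> exists u, f u = v
    & forall w, exists v, h v = w].

Record abExt (K : fieldType) (E A : embTensor K) := AbExt {
  ext_tot : embTensor K;
  ext_i : etMorph A ext_tot;
  ext_p : etMorph ext_tot E;
  ext_exact0 : short_exact (mor0 ext_i) (mor0 ext_p);
  ext_exact1 : short_exact (mor1 ext_i) (mor1 ext_p)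
}.

Definition ext_equiv (K : fieldType) (E A : embTensor K) (X Y : abExt E A) :
    Prop :=
  exists F : etMorph (ext_tot X) (ext_tot Y),
    [/\ forall v, mor0 F (mor0 (ext_i X) v) = mor0 (ext_i Y) v,
        forall w, mor1 F (mor1 (ext_i X) w) = mor1 (ext_i Y) w,
        forall m, mor0 (ext_p Y) (mor0 F m) = mor0 (ext_p X) m
      & forall x, mor1 (ext_p Y) (mor1 F x) = mor1 (ext_p X) x].

Definition ext_induces (K : fieldType) (E A : embTensor K) (X : abExt E A)
    (r : etRep E A) : Prop :=
  forall (s0 : {linear et_mod E -> et_mod (ext_tot X)})
         (s1 : {linear et_alg E -> et_alg (ext_tot X)}),
    cancel s0 (mor0 (ext_p X)) -> cancel s1 (mor1 (ext_p X)) ->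
    [/\ forall x v, mor0 (ext_i X) (rho1 r x v)
                    = et_rho (ext_tot X) (s1 x) (mor0 (ext_i X) v),
        forall x w, mor1 (ext_i X) (rho2 r x w)
                    = br (s1 x) (mor1 (ext_i X) w)
      & forall m w, mor0 (ext_i X) (rho3 r m w)
                    = - et_rho (ext_tot X) (mor1 (ext_i X) w) (s0 m)].

Definition ext_over (K : fieldType) (E A : embTensor K) (r : etRep E A) :=
  {X : abExt E A | ext_induces X r}.

(* Equivalence classes, as predicates: universe constraints rule out the
   library's set on this large type. *)
Definition ext_class (K : fieldType) (E A : embTensor K) (r : etRep E A) :=
  {C : ext_over r -> Prop |
    exists X : ext_over r, C = fun Y => ext_equiv (sval X) (sval Y)}.

Section Cohomology.
Variables (K : fieldType) (E A : embTensor K) (r : etRep E A).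
Local Notation M := (et_mod E).
Local Notation g := (et_alg E).
Local Notation rho := (et_rho E).
Local Notation T := (et_T E).
Local Notation V := (et_mod A).
Local Notation W := (et_alg A).
Local Notation T' := (et_T A).
Local Notation rho1 := (rho1 r).
Local Notation rho2 := (rho2 r).
Local Notation rho3 := (rho3 r).

(* Linear maps out of exterior squares and tensor products are encoded as
   alternating bilinear and bilinear maps; see is_cocycle. *)
Definition cochain : Type :=
  ((M -> W) * (g -> g -> W) * (g -> M -> V))%type.
HB.instance Definition _ := GRing.Lmodule.on cochain.

Definition cocycle_eq1 (c : cochain) (m n : M) : W :=
  let: (theta, omega, nu) := c in
  rho2 (T m) (theta n) - rho2 (T n) (theta m) + omega (T m) (T n)
  - T' (nu (T m) n) - theta (rho (T m) n) + T' (rho3 n (theta m)).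

Definition cocycle_eq2 (c : cochain) (x y z t : g) : W :=
  let: (theta, omega, nu) := c in
  rho2 (br x z) (omega y t) - rho2 (br y t) (omega x z)
  + omega (br x z) (br y t)
  + rho2 t (omega (br x y) z) + rho2 x (omega (br y z) t)
  + rho2 y (omega (br z t) x) + rho2 z (omega (br t x) y)
  - rho2 t (rho2 z (omega x y)) - rho2 x (rho2 t (omega y z))
  - rho2 y (rho2 x (omega z t)) - rho2 z (rho2 y (omega t x))
  - omega (br (br x y) z) t - omega (br (br y z) t) x
  - omega (br (br z t) x) y - omega (br (br t x) y) z.

Definition cocycle_eq3 (c : cochain) (x y z : g) (m : M) : V :=
  let: (theta, omega, nu) := c in
  rho3 m (rho2 z (omega x y)) - rho3 m (omega (br x y) z)
  + nu (br (br x y) z) m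
  - rho1 x (rho1 y (nu z m)) - rho1 x (nu y (rho z m))
  - nu x (rho y (rho z m))
  + rho1 z (rho1 x (nu y m)) + rho1 z (nu x (rho y m))
  + nu z (rho x (rho y m))
  + rho1 y (rho3 m (omega z x)) - rho1 y (nu (br z x) m)
  - nu y (rho (br z x) m)
  - rho3 (rho x m) (omega y z) + rho1 (br y z) (nu x m)
  + nu (br y z) (rho x m).

Record is_cocycle (c : cochain) : Prop := IsCocycle {
  cocycle_lin : linear c.1.1;
  cocycle_bilin : bilinear_for *:%R *:%R c.1.2;
  cocycle_alt : forall x, c.1.2 x x = 0;
  cocycle_bilin' : bilinear_for *:%R *:%R c.2;
  cocycle1 : forall m n, cocycle_eq1 c m n = 0;
  cocycle2 : forall x y z t, cocycle_eq2 c x y z t = 0;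
  cocycle3 : forall x y z m, cocycle_eq3 c x y z m = 0
}.

Definition coboundary (b0 : {linear M -> V}) (b1 : {linear g -> W}) : cochain :=
  (fun m => T' (b0 m) - b1 (T m),
   fun x y => rho2 x (b1 y) - rho2 y (b1 x) - b1 (br x y),
   fun x m => rho1 x (b0 m) - rho3 m (b1 x) - b0 (rho x m)).

Definition cocycles : {pred cochain} := fun c => `[< is_cocycle c >].

Lemma lin_eval2 (U1 U2 : Type) (X : lmodType K) (a : K) (f h : U1 -> U2 -> X) x y :
  (a *: f + h) x y = a *: f x y + h x y.
Proof. by []. Qed.

Lemma lin_eval1 (U1 : Type) (X : lmodType K) (a : K) (f h : U1 -> X) x :
  (a *: f + h) x = a *: f x + h x.
Proof. by []. Qed.

Lemma lin_add (X : lmodType K) (a : K) (u1 u2 v1 v2 u v : X) :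
  u = a *: u1 + u2 -> v = a *: v1 + v2 ->
  u + v = a *: (u1 + v1) + (u2 + v2).
Proof. by move=> -> ->; rewrite addrACA scalerDr. Qed.

Lemma lin_opp (X : lmodType K) (a : K) (u1 u2 u : X) :
  u = a *: u1 + u2 -> - u = a *: - u1 + - u2.
Proof. by move=> ->; rewrite opprD scalerN. Qed.

Lemma cocycle_eq1_lin (a : K) (c d : cochain) m n :
  cocycle_eq1 (a *: c + d) m n = a *: cocycle_eq1 c m n + cocycle_eq1 d m n.
Proof.
case: c d => [[th om] nu] [[th' om'] nu'] /=.
repeat first [apply: lin_add | apply: lin_opp].
all: by rewrite ?(lin_eval2, lin_eval1) ?(linearPr, linearP).
Qed.

Lemma cocycle_eq2_lin (a : K) (c d : cochain) x y z t :
  cocycle_eq2 (a *: c + d) x y z t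
  = a *: cocycle_eq2 c x y z t + cocycle_eq2 d x y z t.
Proof.
case: c d => [[th om] nu] [[th' om'] nu'] /=.
repeat first [apply: lin_add | apply: lin_opp].
all: by rewrite ?(lin_eval2, lin_eval1) ?(linearPr, linearP).
Qed.

Lemma cocycle_eq3_lin (a : K) (c d : cochain) x y z m :
  cocycle_eq3 (a *: c + d) x y z m
  = a *: cocycle_eq3 c x y z m + cocycle_eq3 d x y z m.
Proof.
case: c d => [[th om] nu] [[th' om'] nu'] /=.
repeat first [apply: lin_add | apply: lin_opp].
all: by rewrite ?(lin_eval2, lin_eval1) ?(linearPr, linearP).
Qed.

Lemma lin_linear (U X : lmodType K) (a : K) (f h : U -> X) :
  linear f -> linear h -> linear (a *: f + h).
Proof.
move=> fL hL b u v.
by rewrite !lin_eval1 fL hL !scalerDr !scalerA [a * b]mulrC addrACA.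
Qed.

Lemma lin_bilinear (U1 U2 X : lmodType K) (a : K) (f h : U1 -> U2 -> X) :
  bilinear_for *:%R *:%R f -> bilinear_for *:%R *:%R h ->
  bilinear_for *:%R *:%R (a *: f + h).
Proof.
by move=> [fl fr] [hl hr]; split=> u; apply: lin_linear.
Qed.

Lemma cocycles_submod_closed : submod_closed cocycles.
Proof.
have cocycle0 : is_cocycle 0.
  have z0 : (-1) *: (0 : cochain) + 0 = 0 by rewrite scaler0 addr0.
  split=> [b u v||//||m n|x y z t|x y z m].
  - by rewrite /= scaler0 addr0.
  - by split=> u b x y /=; rewrite scaler0 addr0.
  - by split=> u b x y /=; rewrite scaler0 addr0.
  - by rewrite -z0 cocycle_eq1_lin scaleN1r addNr.
  - by rewrite -z0 cocycle_eq2_lin scaleN1r addNr.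
  - by rewrite -z0 cocycle_eq3_lin scaleN1r addNr.
split=> [|a c d /asboolP + /asboolP +]; first exact/asboolP.
move=> cP dP; apply/asboolP; move: cP dP; case: c d => [[th om] nu] [[th' om'] nu'].
case=> th_lin om_bil om_alt nu_bil c1 c2 c3.
case=> th'_lin om'_bil om'_alt nu'_bil d1 d2 d3.
split=> [||x||m n|x y z t|x y z m].
- exact: (@lin_linear _ _ a th th').
- exact: (@lin_bilinear _ _ _ a om om').
- have /= omx := om_alt x; have /= om'x := om'_alt x.
  by rewrite /= lin_eval2 omx om'x scaler0 addr0.
- exact: (@lin_bilinear _ _ _ a nu nu').
- by rewrite cocycle_eq1_lin c1 d1 scaler0 addr0.
- by rewrite cocycle_eq2_lin c2 d2 scaler0 addr0.
- by rewrite cocycle_eq3_lin c3 d3 scaler0 addr0.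
Qed.
HB.instance Definition _ :=
  GRing.isSubmodClosed.Build K cochain cocycles cocycles_submod_closed.

Record Z2 : Type := MkZ2 { Z2_val : cochain; Z2P : Z2_val \in cocycles }.
HB.instance Definition _ := [isSub for Z2_val].
HB.instance Definition _ := [Choice of Z2 by <:].
HB.instance Definition _ := [SubChoice_isSubLmodule of Z2 by <:].

(* B2 is a predicate on Z2: every coboundary is a cocycle when A is abelian, so
   nothing is lost by intersecting with Z2. *)
Definition B2 : {pred Z2} :=
  fun c => `[< exists b0 b1, val c = coboundary b0 b1 >].

Lemma coboundary0 : coboundary \0 \0 = 0.
Proof.
congr (_, _, _).
- by apply/funext => m /=; rewrite linear0 subr0.
- by apply/funext => x; apply/funext => y /=; rewrite !linear0r !subr0.
- by apply/funext => x; apply/funext => m /=; rewrite !linear0r !subr0.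
Qed.

Lemma lin_cochain (a : K) (th th' : M -> W) (om om' : g -> g -> W)
    (nu nu' : g -> M -> V) :
  a *: ((th, om, nu) : cochain) + ((th', om', nu') : cochain)
  = (a *: th + th', a *: om + om', a *: nu + nu') :> cochain.
Proof. by []. Qed.

Lemma coboundary_lin (a : K) (b0 d0 : {linear M -> V})
    (b1 d1 : {linear g -> W}) :
  coboundary (a \*: b0 \+ d0) (a \*: b1 \+ d1)
  = a *: coboundary b0 b1 + coboundary d0 d1.
Proof.
rewrite /coboundary lin_cochain; congr (_, _, _).
- apply/funext => m; rewrite lin_eval1.
  by repeat first [apply: lin_add | apply: lin_opp]; rewrite ?linearP.
- apply/funext => x; apply/funext => y; rewrite lin_eval2.
  by repeat first [apply: lin_add | apply: lin_opp]; rewrite ?linearPr.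
- apply/funext => x; apply/funext => m; rewrite lin_eval2.
  by repeat first [apply: lin_add | apply: lin_opp]; rewrite ?linearPr.
Qed.

Lemma B2_submod_closed : submod_closed B2.
Proof.
split=> [|a c d /asboolP[b0 [b1 cE]] /asboolP[d0 [d1 dE]]]; apply/asboolP.
  by exists \0, \0; rewrite coboundary0 linear0.
exists (a \*: b0 \+ d0), (a \*: b1 \+ d1).
by rewrite coboundary_lin -cE -dE linearP.
Qed.
HB.instance Definition _ :=
  GRing.isSubmodClosed.Build K Z2 B2 B2_submod_closed.

Definition H2 := Quotient.quot B2.
HB.instance Definition _ := GRing.Zmodule.on H2.
End Cohomology.

(* Main.v *)
Require Import Defs.
From HB Require Import structures.
From mathcomp Require Import all_boot all_order all_algebra.
From mathcomp Require Import boolp classical_sets functions.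

Import GRing.Theory.
Local Open Scope ring_scope.

Set Implicit Arguments.
Unset Strict Implicit.
Unset Printing Implicit Defensive.

(** As for group extensions, an abelian extension is, after a choice of linear
    sections, the product of the base and the kernel with its operations
    twisted by a cochain, and the axioms of an embedding tensor hold for the
    twisted operations exactly when that cochain is a cocycle.

    Each of the three axioms (Malcev identity, representation identity,
    compatibility of T) is written as the vanishing of a defect.  For the
    product twisted by an arbitrary cochain c, the defect is the pair formed by
    the defect of the base and the corresponding cocycle expression of c
    (tw_sagle, tw_rep_defect, tw_emb_defect): the conditions on the
    representation (rho1, rho2, rho3) are precisely what makes the
    contributions of the kernel cancel.  These three equalities serve in both
    directions.  A cocycle has zero defects, so it yields an extension
    (tw_ext).  Conversely, linear sections of an extension (linear_section)
    identify it with a twisted product by an injective map which preserves the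
    operations, hence the defects, so that the cochain measuring the failure of
    the sections to be morphisms is a cocycle (tw_ext_presents).

    An equivalence between two twisted products restricts to the identity on
    the kernel and induces the identity on the base, so it is a shear
    (x, u) |-> (x, u + b x), and a pair of shears is a morphism from the
    product twisted by c to the one twisted by d if and only if c - d is the
    coboundary of the pair (tw_ext_equiv).  Sending an extension to the
    cohomology class of a cocycle presenting it is therefore well defined, and
    its fibres are the equivalence classes.

    The Malcev identity has a repeated variable, whereas the cocycle condition
    comes from its multilinear form, due to Sagle.  The two forms are
    equivalent when 2 is invertible (malcev_sagle).  The other use of the
    characteristic is that a skew-symmetric bracket is then alternating. *)

(** * Identities in abelian groups *)

(** The comparisons of defects below are equalities of sums of a few dozen
    signed terms in a vector space; they are decided by comparing the integer
    coefficients of the terms. *)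
Inductive zexpr : Type :=
  | ZAtom of nat
  | ZZero
  | ZAdd of zexpr & zexpr
  | ZOpp of zexpr.

Fixpoint zeval (V : zmodType) (env : seq V) (e : zexpr) : V :=
  match e with
  | ZAtom i => env`_i
  | ZZero => 0
  | ZAdd e1 e2 => zeval env e1 + zeval env e2
  | ZOpp e1 => - zeval env e1
  end.

Fixpoint zcoef (e : zexpr) (i : nat) : int :=
  match e with
  | ZAtom j => if j == i then 1 else 0
  | ZZero => 0
  | ZAdd e1 e2 => zcoef e1 i + zcoef e2 i
  | ZOpp e1 => - zcoef e1 i
  end.

(** Out of range atoms evaluate to the default value 0, so the sum over the
    environment accounts for every atom. *)
Lemma zevalE (V : zmodType) (env : seq V) e :
  zeval env e = \sum_(i < size env) env`_i *~ zcoef e i.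
Proof.
elim: e => [j||e1 IH1 e2 IH2|e IH] /=.
- have [ltj|gej] := ltnP j (size env).
    rewrite (bigD1 (Ordinal ltj)) //= eqxx mulr1z big1 ?addr0 // => i.
    by rewrite -val_eqE /= eq_sym => /negbTE ->; rewrite mulr0z.
  rewrite nth_default // big1 // => i _.
  by rewrite gtn_eqF ?mulr0z // (leq_trans (ltn_ord i)).
- by rewrite big1 // => i _; rewrite mulr0z.
- by rewrite IH1 IH2 -big_split; apply: eq_bigr => i _; rewrite mulrzDr.
- by rewrite IH -sumrN; apply: eq_bigr => i _; rewrite mulrNz.
Qed.

Lemma zeval_eq (V : zmodType) (env : seq V) e1 e2 :
  all (fun i => zcoef e1 i == zcoef e2 i) (iota 0 (size env)) ->
  zeval env e1 = zeval env e2.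
Proof.
move=> /allP eqc; rewrite !zevalE; apply: eq_bigr => i _.
by rewrite (eqP (eqc _ _)) // mem_iota ltn_ord.
Qed.

(** Atoms are compared up to conversion: the same vector often occurs with
    different but convertible paths of algebraic structures. *)
Ltac zindex x env :=
  lazymatch env with
  | ?y :: ?env' =>
    match constr:(tt) with
    | _ => let _ := match constr:(tt) with _ => unify x y end in
           constr:(0%N)
    | _ => let n := zindex x env' in constr:(n.+1)
    end
  end.

Ltac zatoms t env :=
  lazymatch t with
  | 0%R => env
  | (?a + ?b)%R => let env' := zatoms a env in zatoms b env'
  | (- ?a)%R => zatoms a env
  | _ => match constr:(tt) with
         | _ => let _ := zindex t env in env
         | _ => constr:(t :: env)
         end
  end.

Ltac zquote t env :=
  lazymatch t with
  | 0%R => constr:(ZZero)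
  | (?a + ?b)%R =>
    let a' := zquote a env in let b' := zquote b env in constr:(ZAdd a' b')
  | (- ?a)%R => let a' := zquote a env in constr:(ZOpp a')
  | _ => let i := zindex t env in constr:(ZAtom i)
  end.

(** Every subterm other than a sum, an opposite or zero is an atom. *)
Ltac zmodule :=
  lazymatch goal with
  | |- @eq ?V ?a ?b =>
    let env := zatoms a (@nil V) in
    let env := zatoms b env in
    let a' := zquote a env in
    let b' := zquote b env in
    apply: (@zeval_eq _ env a' b'); vm_compute; reflexivity
  end.

(** * Linear sections *)

(** Zorn's lemma gives a subspace G maximal among those that meet the kernel of
    p trivially.  It maps onto V: if v = p u0 were not in p G, adding the line
    of u0 to G would preserve injectivity.  The section is the inverse of the
    restriction of p to G. *)
Lemma linear_section (K : fieldType) (U V : lmodType K) (p : {linear U -> V}) :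
  (forall v, exists u, p u = v) -> exists s : {linear V -> U}, cancel s p.
Proof.
move=> psurj.
(* The empty set satisfies P, as the union of the empty chain must. *)
pose P (G : set U) := (forall a u v, G u -> G v -> G (a *: u + v)) /\
  (forall u, G u -> p u = 0 -> u = 0).
have [|G [[Glin Ginj] Gmax]] := @Zorn_bigcup U P.
  move=> F FP Ftot; split=> [a u v [A FA Au] [B FB Bv]|u [A FA Au]]; last first.
    exact: (FP A FA).2.
  have [AB|BA] := Ftot _ _ FA FB.
    by exists B => //; apply: (FP B FB).1 => //; apply: AB.
  by exists A => //; apply: (FP A FA).1 => //; apply: BA.
(* If G were empty, the zero subspace would be strictly larger. *)
have G0 : G 0.
  apply: contrapT => nG0; apply: (Gmax [set 0]%classic); last first.
    by split=> [a u v -> ->|u ->]; rewrite ?scaler0 ?addr0.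
  have G_0 u : ~ G u.
    by move=> Gu; apply: nG0; rewrite -(addNr u) -scaleN1r; apply: Glin.
  by split=> [u /G_0//|h]; apply: (G_0 0); apply: h.
have Gsurj v : exists u, G u /\ p u = v.
  apply: contrapT => nv; have [u0 pu0] := psurj v.
  apply: (Gmax [set u | exists a w, G w /\ u = a *: u0 + w]%classic).
    split=> [u Gu|h]; first by exists 0, u; rewrite scale0r add0r.
    apply: nv; exists u0; split=> //; apply: h.
    by exists 1, 0; rewrite scale1r addr0.
  split=> [a _ _ [b [w [Gw ->]]] [b' [w' [Gw' ->]]]|_ [a [w [Gw ->]]]].
    exists (a * b + b'), (a *: w + w'); split; first exact: Glin.
    by rewrite scalerDr scalerA scalerDl addrACA.
  rewrite linearP pu0; have [->|a0] := eqVneq a 0.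
    by rewrite !scale0r !add0r; apply: Ginj.
  move=> /eqP; rewrite addr_eq0 => /eqP eqv; case: nv.
  exists (- a^-1 *: w + 0); split; first exact: Glin.
  by rewrite addr0 linearZ /= scaleNr -scalerN -eqv scalerA mulVf // scale1r.
have Guniq u v : G u -> G v -> p u = p v -> u = v.
  move=> Gu Gv puv; apply/eqP; rewrite -subr_eq0; apply/eqP.
  have -> : u - v = -1 *: v + u by rewrite scaleN1r addrC.
  by apply: Ginj; [apply: Glin | rewrite linearP puv scaleN1r addNr].
pose s v := projT1 (cid (Gsurj v)).
have sP v : G (s v) /\ p (s v) = v := projT2 (cid (Gsurj v)).
have slin : linear s.
  move=> a u v; have [Gu pu] := sP u; have [Gv pv] := sP v.
  have [Guv puv] := sP (a *: u + v).
  by apply: Guniq => //; [apply: Glin | rewrite puv linearP pu pv].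
pose sL : {linear V -> U} :=
  HB.pack s (GRing.isLinear.Build K V U *:%R s slin).
by exists sL => v; case: (sP v).
Qed.

(** * Defects of the axioms and the Sagle form of the Malcev identity *)

Section Defects.
Variables (G N : zmodType) (b : G -> G -> G) (r : G -> N -> N) (T : N -> G).

Definition sagle (x y z t : G) : G :=
  b (b x z) (b y t) - (b (b (b x y) z) t + b (b (b y z) t) x
                       + b (b (b z t) x) y + b (b (b t x) y) z).

Definition rep_defect (x y z : G) (m : N) : N :=
  r (b (b x y) z) m - (r x (r y (r z m)) - r z (r x (r y m))
                       + r y (r (b z x) m) - r (b y z) (r x m)).

Definition emb_defect (m n : N) : G := b (T m) (T n) - T (r (T m) n).

End Defects.

Lemma double_eq0 (K : fieldType) (V : lmodType K) (charK : [pchar K] =i pred0)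
  (v : V) : v + v = 0 -> v = 0.
Proof.
have n2 : (2%:R : K) != 0 by move: (charK 2%N); rewrite inE /= => ->.
move=> vv0; apply: (scalerI n2).
by rewrite scaler0 scaler_nat mulr2n.
Qed.

Section Sagle.
Variables (K : fieldType) (charK : [pchar K] =i pred0) (g : lmodType K).
Variable b : {bilinear g -> g -> g}.
Hypothesis skew : forall x y, b x y = - b y x.

Lemma skew_diag x : b x x = 0.
Proof. by apply: (double_eq0 charK); rewrite {2}skew subrr. Qed.

Lemma sagle_diag x y z :
  sagle b x y z x = jacobian b x y (b x z) - b (jacobian b x y z) x.
Proof.
rewrite /sagle /jacobian skew_diag !linear0l !(linearDl b).
rewrite (skew y (b x z)) (skew (b x y) (b x z)) (skew x y) (skew z x).
rewrite ?(linearNl, linearNr, opprK).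
zmodule.
Qed.

(** The term [[x, z], [y, t]] is itself invariant under the cyclic shift, by
    two uses of skew-symmetry. *)
Lemma sagle_cycle x y z t : sagle b y z t x = sagle b x y z t.
Proof.
rewrite /sagle (skew (b y t)) (skew z x) linearNl opprK; zmodule.
Qed.

Lemma sagle_linear_ends x t y z : sagle b (x + t) y z (x + t) =
  sagle b x y z x + sagle b t y z t + sagle b x y z t + sagle b t y z x.
Proof.
rewrite /sagle ?(linearDl, linearDr); zmodule.
Qed.

(** The Malcev identity says that the Sagle defect vanishes when its first and
    last arguments coincide.  Polarised, this makes the defect change sign when
    these arguments are exchanged; with its cyclic invariance, it then changes
    sign under every transposition.  But a 4-cycle is odd and preserves the
    defect, so the defect is its own opposite. *)
Lemma malcev_sagle :
  (forall x y z, jacobian b x y (b x z) = b (jacobian b x y z) x) <->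
  (forall x y z t, sagle b x y z t = 0).
Proof.
split=> [mal x y z t|sag x y z]; last first.
  by apply/eqP; rewrite -subr_eq0 -sagle_diag sag.
have diag u v w : sagle b u v w u = 0 by rewrite sagle_diag mal subrr.
have swap14 u v w s : sagle b u v w s = - sagle b s v w u.
  apply/eqP; rewrite -addr_eq0; apply/eqP.
  by rewrite -[RHS](diag (u + s) v w) sagle_linear_ends !diag !add0r.
have swap12 u v w s : sagle b u v w s = - sagle b v u w s.
  by rewrite -sagle_cycle swap14 -(sagle_cycle v).
(* Three exchanges of the first two arguments, separated by shifts, compose to
   the identity up to a shift. *)
apply: (double_eq0 charK); rewrite {1}swap12 -(sagle_cycle y) swap12.
by rewrite -(sagle_cycle z) swap12 -(sagle_cycle t) !opprK addNr.
Qed.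
End Sagle.

(** * The product twisted by a cochain *)

(** The representation identity with its first two variables exchanged: the form
    that the Sagle defect produces when one argument lies in the kernel. *)
Lemma malcev_rep_swap (K : fieldType) (g : malcev K) (M : lmodType K)
    (rho : {bilinear g -> M -> M}) : malcev_rep rho ->
  forall x y z m, rho (br (br x y) z) m =
    rho z (rho y (rho x m)) - rho y (rho x (rho z m))
    + rho x (rho (br y z) m) + rho (br x z) (rho y m).
Proof.
move=> rhoP x y z m.
rewrite (malcev_skew x y) (malcev_skew y z).
rewrite ?(linearNl, linearNr) rhoP; zmodule.
Qed.

Section Twist.
Variables (K : fieldType) (E A : embTensor K) (r : etRep E A).
Variable c : cochain E A.
Local Notation M := (et_mod E).
Local Notation g := (et_alg E).
Local Notation rho := (et_rho E).
Local Notation T := (et_T E).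
Local Notation V := (et_mod A).
Local Notation W := (et_alg A).
Local Notation T' := (et_T A).
Local Notation rho1 := (rho1 r).
Local Notation rho2 := (rho2 r).
Local Notation rho3 := (rho3 r).

Definition tw_br (a b : g * W) : g * W :=
  (br a.1 b.1, rho2 a.1 b.2 - rho2 b.1 a.2 + c.1.2 a.1 b.1).

(** The minus sign: rho3 m w is the opposite of the action of w on a lift of
    m. *)
Definition tw_rho (a : g * W) (n : M * V) : M * V :=
  (rho a.1 n.1, rho1 a.1 n.2 - rho3 n.1 a.2 + c.2 a.1 n.1).

Definition tw_T (n : M * V) : g * W := (T n.1, T' n.2 + c.1.1 n.1).

(** The terms in v and v' cancel because T' intertwines rho1 with rho2, and by
    the compatibility of rho3 with T and T'. *)
Lemma tw_emb_defect m n : emb_defect tw_br tw_rho tw_T m n =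
  (emb_defect (@malcev_br K g) rho T m.1 n.1, cocycle_eq1 r c m.1 n.1).
Proof.
rewrite /emb_defect /tw_br /tw_rho /tw_T.
case: c m n => [[th om] nu] [m v] [n v'].
congr pair; rewrite /cocycle_eq1 /=.
rewrite !(linearDr, linearD, linearB, linearN) /= !rho12T !rho23T.
zmodule.
Qed.

(** The Sagle identity with three arguments in the base and one in the kernel is
    the representation identity of rho2, whichever place the latter argument
    takes; terms with two arguments in the kernel are zero. *)
Lemma tw_sagle a1 a2 a3 a4 : sagle tw_br a1 a2 a3 a4 =
  (sagle (@malcev_br K g) a1.1 a2.1 a3.1 a4.1,
   cocycle_eq2 r c a1.1 a2.1 a3.1 a4.1).
Proof.
rewrite /sagle /tw_br.
case: c a1 a2 a3 a4 => [[th om] nu] [x u] [y v] [z w] [t s].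
congr pair; rewrite /cocycle_eq2 /=.
rewrite !(linearDr, linearNr) /= !(malcev_rep_swap (@rho2P K E A r)).
(* Brackets of two base elements are given the order x, y, z, t, so that
   opposite terms have the same atoms. *)
rewrite ?(malcev_skew y x) ?(malcev_skew z x) ?(malcev_skew t x).
rewrite ?(malcev_skew z y) ?(malcev_skew t y) ?(malcev_skew t z).
rewrite ?(linearNl, linearNr) /=.
zmodule.
Qed.

(** The terms in v, w and u, the kernel components of the second, third and
    first algebra arguments, are the three compatibility conditions on rho3; the
    term in s is the representation identity of rho1. *)
Lemma tw_rep_defect a1 a2 a3 n : rep_defect tw_br tw_rho a1 a2 a3 n =
  (rep_defect (@malcev_br K g) rho a1.1 a2.1 a3.1 n.1,
   cocycle_eq3 r c a1.1 a2.1 a3.1 n.1).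
Proof.
rewrite /rep_defect /tw_br /tw_rho.
case: c a1 a2 a3 n => [[th om] nu] [x u] [y v] [z w] [m s].
congr pair; rewrite /cocycle_eq3 /=.
rewrite !(linearDr, linearNr) /= (@rho1P K E A r).
have e1 := rho_compat1 r z x m v.
have e2 := rho_compat2 r x y m w.
have e3 := rho_compat3 r z y m u.
rewrite -[RHS]addr0 -[X in _ = _ + X]e1 -[RHS]subr0 -[X in _ = _ - X]e2.
rewrite -[RHS]subr0 -[X in _ = _ - X]e3 (malcev_skew y z) linearNl.
zmodule.
Qed.
End Twist.

(** * The extension defined by a cocycle *)

Section TwistedEmbedding.
Variables (K : fieldType) (charK : [pchar K] =i pred0).
Variables (E A : embTensor K) (r : etRep E A).
Local Notation M := (et_mod E).
Local Notation g := (et_alg E).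
Local Notation V := (et_mod A).
Local Notation W := (et_alg A).

Variable c : Z2 r.
Let cP : is_cocycle r (val c) := asboolW (Z2P c).

Lemma tw_br_bilinear : bilinear_for *:%R *:%R (tw_br r (val c)).
Proof.
have [coml comr] := cocycle_bilin cP.
split=> [b a x y|a b x y]; congr pair; rewrite /= ?(linearPl, linearPr) //.
  rewrite (coml b.1 a); repeat first [apply: lin_add | apply: lin_opp];
  by rewrite ?(linearPl, linearPr).
rewrite (comr a.1 b); repeat first [apply: lin_add | apply: lin_opp];
by rewrite ?(linearPl, linearPr).
Qed.

HB.instance Definition _ :=
  bilinear_isBilinear.Build K (g * W)%type (g * W)%type (g * W)%type
    *:%R *:%R (tw_br r (val c)) tw_br_bilinear.

Lemma tw_rho_bilinear : bilinear_for *:%R *:%R (tw_rho r (val c)).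
Proof.
have [coml comr] := cocycle_bilin' cP.
split=> [b a x y|a b x y]; congr pair; rewrite /= ?(linearPl, linearPr) //.
  rewrite (coml b.1 a); repeat first [apply: lin_add | apply: lin_opp];
  by rewrite ?(linearPl, linearPr).
rewrite (comr a.1 b); repeat first [apply: lin_add | apply: lin_opp];
by rewrite ?(linearPl, linearPr).
Qed.

HB.instance Definition _ :=
  bilinear_isBilinear.Build K (g * W)%type (M * V)%type (M * V)%type
    *:%R *:%R (tw_rho r (val c)) tw_rho_bilinear.

Lemma tw_T_linear : linear (tw_T (val c)).
Proof.
move=> a x y; congr pair; rewrite /= ?linearP //.
by rewrite (cocycle_lin cP); apply: lin_add.
Qed.

HB.instance Definition _ :=
  GRing.isLinear.Build K (M * V)%type (g * W)%type *:%R (tw_T (val c))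
    tw_T_linear.

Lemma cocycle_skew x y : (val c).1.2 x y = - (val c).1.2 y x.
Proof.
have [coml comr] := cocycle_bilin cP; have alt := cocycle_alt cP.
apply/eqP; rewrite -addr_eq0; apply/eqP.
have /= := alt (1 *: x + y).
rewrite (coml (1 *: x + y) 1 x y) (comr x 1 x y) (comr y 1 x y) !alt.
by rewrite /= !scale1r add0r addr0.
Qed.

Lemma tw_skew a b : tw_br r (val c) a b = - tw_br r (val c) b a.
Proof.
congr pair; rewrite /= ?(malcev_skew a.1 b.1) // (cocycle_skew a.1).
zmodule.
Qed.

Lemma tw_malcev_id x y z :
  jacobian (tw_br r (val c)) x y (tw_br r (val c) x z) =
  tw_br r (val c) (jacobian (tw_br r (val c)) x y z) x.
Proof.
have [_ sag] := malcev_sagle charK tw_skew; apply: sag => {}x {}y {}z t.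
rewrite tw_sagle (cocycle2 cP).
have [mal _] := malcev_sagle charK (@malcev_skew K g).
by rewrite mal //; apply: malcev_id.
Qed.

Definition tw_malcev : malcev K := Malcev tw_skew tw_malcev_id.

Lemma tw_rhoP : @malcev_rep K tw_malcev _ (tw_rho r (val c)).
Proof.
move=> x y z m; apply/eqP; rewrite -subr_eq0; apply/eqP.
apply: etrans (tw_rep_defect r (val c) x y z m) _.
by rewrite (cocycle3 cP) /rep_defect et_rhoP subrr.
Qed.

Lemma tw_TP m n : tw_br r (val c) (tw_T (val c) m) (tw_T (val c) n) =
  tw_T (val c) (tw_rho r (val c) (tw_T (val c) m) n).
Proof.
apply/eqP; rewrite -subr_eq0; apply/eqP.
apply: etrans (tw_emb_defect r (val c) m n) _.
by rewrite (cocycle1 cP) /emb_defect et_TP subrr.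
Qed.

Definition tw_emb : embTensor K := @EmbTensor K _ tw_malcev _ _ tw_rhoP tw_TP.

End TwistedEmbedding.

Lemma linear_fun0 (K : fieldType) (U V : lmodType K) (f : U -> V) :
  linear f -> f 0 = 0.
Proof. by move=> /(_ (-1) 0 0); rewrite !scaleN1r !addNr. Qed.

Section Shear.
Variables (K : fieldType) (U V : lmodType K).

Definition in_snd (v : V) : U * V := (0, v).

Lemma in_snd_linear : linear in_snd.
Proof. by move=> a u v; congr pair; rewrite /= scaler0 addr0. Qed.

HB.instance Definition _ :=
  GRing.isLinear.Build K V (U * V)%type *:%R in_snd in_snd_linear.

Definition out_fst (a : U * V) : U := a.1.

Lemma out_fst_linear : linear out_fst.
Proof. by []. Qed.

HB.instance Definition _ :=
  GRing.isLinear.Build K (U * V)%type U *:%R out_fst out_fst_linear.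

Lemma in_snd_out_fst_exact : short_exact in_snd out_fst.
Proof.
split=> [u v []//|[u v]|u]; last by exists (u, 0).
by split=> [/= ->|[w []] //]; exists v.
Qed.

Definition shear (b : U -> V) (a : U * V) : U * V := (a.1, a.2 + b a.1).

Variable b : {linear U -> V}.

Lemma shear_linear : linear (shear b).
Proof.
by move=> a x y; congr pair; rewrite /= linearP; apply: lin_add.
Qed.

HB.instance Definition _ :=
  GRing.isLinear.Build K (U * V)%type (U * V)%type *:%R (shear b) shear_linear.

End Shear.

Section TwistedExtension.
Variables (K : fieldType) (charK : [pchar K] =i pred0).
Variables (E A : embTensor K) (abA : et_abelian A) (r : etRep E A).
Local Notation M := (et_mod E).
Local Notation g := (et_alg E).
Local Notation V := (et_mod A).
Local Notation W := (et_alg A).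
Local Notation T := (et_T E).
Local Notation T' := (et_T A).
Local Notation rho1 := (rho1 r).
Local Notation rho2 := (rho2 r).
Local Notation rho3 := (rho3 r).

Section Extension.
Variable c : Z2 r.
Let cP : is_cocycle r (val c) := asboolW (Z2P c).

Local Notation i0 := (@in_snd K M V).
Local Notation i1 := (@in_snd K g W).

Lemma tw_i_T m : et_T (tw_emb charK c) (i0 m) = i1 (et_T A m).
Proof.
have th0 : (val c).1.1 0 = 0 by apply: linear_fun0 (cocycle_lin cP).
by congr pair; rewrite /= ?linear0 // th0 addr0.
Qed.

Lemma tw_i_br x y :
  i1 (br x y) = malcev_br (et_alg (tw_emb charK c)) (i1 x) (i1 y).
Proof.
have om0 : (val c).1.2 0 0 = 0 by apply: cocycle_alt cP _.
have [br0 _ _] := abA; rewrite br0.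
by congr pair; rewrite /= !linear0l // om0 subrr addr0.
Qed.

Lemma tw_i_rho x m : i0 (et_rho A x m) = et_rho (tw_emb charK c) (i1 x) (i0 m).
Proof.
have nu0 : (val c).2 0 0 = 0.
  by apply: linear_fun0 ((cocycle_bilin' cP).2 0).
have [_ _ rho0] := abA; rewrite rho0.
by congr pair; rewrite /= !linear0l // nu0 subrr addr0.
Qed.

Definition tw_i : etMorph A (tw_emb charK c) :=
  @EtMorph K A (tw_emb charK c) i0 i1 tw_i_T tw_i_br tw_i_rho.

Definition tw_p : etMorph (tw_emb charK c) E :=
  @EtMorph K (tw_emb charK c) E (@out_fst K M V) (@out_fst K g W)
   (fun=> erefl) (fun _ _ => erefl) (fun _ _ => erefl).

Definition tw_ext : abExt E A :=
  @AbExt K E A (tw_emb charK c) tw_i tw_p (in_snd_out_fst_exact M V)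
    (in_snd_out_fst_exact g W).

End Extension.

(** The kernel components of the sections are invisible here, because the
    twisted operations contain no product of two kernel components. *)
Lemma tw_ext_induces (c : Z2 r) : ext_induces (tw_ext c) r.
Proof.
move=> s0 s1 s0K s1K.
have cP : is_cocycle r (val c) := asboolW (Z2P c).
have om0 x : (val c).1.2 x 0 = 0.
  by apply: linear_fun0 ((cocycle_bilin cP).2 x).
have nu0 x : (val c).2 x 0 = 0.
  by apply: linear_fun0 ((cocycle_bilin' cP).2 x).
have nu0l m : (val c).2 0 m = 0.
  by apply: linear_fun0 ((cocycle_bilin' cP).1 m).
have s0E m : (s0 m).1 = m := s0K m.
have s1E x : (s1 x).1 = x := s1K x.
split=> [x v|x w|m w]; congr pair; rewrite /= ?s0E ?s1E.
- by rewrite linear0r.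
- by rewrite linear0l nu0 subr0 addr0.
- by rewrite linear0r.
- by rewrite linear0l om0 subr0 addr0.
- by rewrite linear0l oppr0.
- by rewrite linear0l nu0l sub0r addr0 opprK.
Qed.

Lemma cochain_ext (c d : cochain E A) :
  (forall m, c.1.1 m = d.1.1 m) -> (forall x y, c.1.2 x y = d.1.2 x y) ->
  (forall x m, c.2 x m = d.2 x m) -> c = d.
Proof.
case: c d => [[th om] nu] [[th' om'] nu'] /= eq_th eq_om eq_nu.
congr (_, _, _); apply/funext => x; first exact: eq_th.
  by apply/funext => y; apply: eq_om.
by apply/funext => m; apply: eq_nu.
Qed.

(** The coboundary equations are put in the form in which they arise when the
    shears by b0 and b1 are compared with T, with the brackets and with the
    actions of the two twisted products. *)
Lemma coboundary_subP (c d : Z2 r)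
    (b0 : {linear M -> V}) (b1 : {linear g -> W}) :
  val (c - d) = coboundary r b0 b1 <->
  [/\ forall m, T' (b0 m) + (val d).1.1 m = (val c).1.1 m + b1 (T m),
      forall x y, (val c).1.2 x y + b1 (br x y) =
        rho2 x (b1 y) - rho2 y (b1 x) + (val d).1.2 x y
    & forall x m, (val c).2 x m + b0 (et_rho E x m) =
        rho1 x (b0 m) - rho3 m (b1 x) + (val d).2 x m].
Proof.
have -> : val (c - d) = val c - val d by exact: raddfB.
split=> [/eqP|[thE omE nuE]].
  rewrite subr_eq => /eqP cE; split=> [m|x y|x m].
  - have -> : (val c).1.1 m = T' (b0 m) - b1 (T m) + (val d).1.1 m
      by rewrite cE.
    zmodule.
  - have -> : (val c).1.2 x y =
      rho2 x (b1 y) - rho2 y (b1 x) - b1 (br x y) + (val d).1.2 x y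
      by rewrite cE.
    zmodule.
  - have -> : (val c).2 x m =
      rho1 x (b0 m) - rho3 m (b1 x) - b0 (et_rho E x m) + (val d).2 x m
      by rewrite cE.
    zmodule.
apply/eqP; rewrite subr_eq; apply/eqP.
apply: cochain_ext => [m|x y|x m].
- apply: (addIr (b1 (T m))); rewrite -thE.
  transitivity (T' (b0 m) - b1 (T m) + (val d).1.1 m + b1 (T m)) => //; zmodule.
- apply: (addIr (b1 (br x y))); rewrite omE.
  transitivity (rho2 x (b1 y) - rho2 y (b1 x) - b1 (br x y) + (val d).1.2 x y
    + b1 (br x y)) => //; zmodule.
- apply: (addIr (b0 (et_rho E x m))); rewrite nuE.
  transitivity (rho1 x (b0 m) - rho3 m (b1 x) - b0 (et_rho E x m)
    + (val d).2 x m + b0 (et_rho E x m)) => //; zmodule.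
Qed.

(** A linear endomorphism over U of the product and under X is a shear. *)
Lemma shear_of (U X : lmodType K) (F : {linear (U * X)%type -> (U * X)%type}) :
  (forall x, F (0, x) = (0, x)) -> (forall a, (F a).1 = a.1) ->
  exists b : {linear U -> X}, forall u x, F (u, x) = (u, x + b u).
Proof.
move=> F0 F1; pose b u := (F (u, 0)).2.
have blin : linear b.
  move=> a u v; rewrite /b -[RHS]/(a *: F (u, 0) + F (v, 0)).2 -linearP.
  by congr (F _).2; congr pair; rewrite /= scaler0 addr0.
exists (HB.pack b (GRing.isLinear.Build K U X *:%R b blin) : {linear U -> X}).
move=> u x; have -> : (u, x) = (0, x) + (u, 0) :> U * X.
  by congr pair; rewrite /= ?add0r ?addr0.
rewrite linearD F0 [F (u, 0)]surjective_pairing F1.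
by congr pair; rewrite /= add0r.
Qed.

(** Equivalences are pairs of shears, and the kernel components of the equations
    that make such a pair a morphism are those of a coboundary. *)
Lemma tw_ext_equiv (c d : Z2 r) :
  ext_equiv (tw_ext c) (tw_ext d) <-> c - d \in @B2 K E A r.
Proof.
split=> [[F [F0i F1i F0p F1p]]|/asboolP[b0 [b1 /coboundary_subP[thE omE nuE]]]].
  have [b0 b0E] := @shear_of M V (mor0 F) F0i F0p.
  have [b1 b1E] := @shear_of g W (mor1 F) F1i F1p.
  apply/asboolP; exists b0, b1; apply/coboundary_subP; split=> [m|x y|x m].
  - have := congr1 snd (mor_T F (m, 0)).
    by rewrite (b0E m 0) /= (b1E (T m)) /= linear0 !add0r => <-.
  - have := congr1 snd (mor_br F (x, 0) (y, 0)).
    rewrite (b1E (br x y)) (b1E x) (b1E y) /= !linear0r subr0 !add0r.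
    exact.
  - have := congr1 snd (mor_rho F (x, 0) (m, 0)).
    rewrite (b0E (et_rho E x m)) (b1E x) (b0E m) /= !linear0r subr0 !add0r.
    exact.
have FT m : et_T (tw_emb charK d) (shear b0 m) =
    shear b1 (et_T (tw_emb charK c) m).
  by congr pair; rewrite /= linearD -!addrA thE.
have Fbr x y : shear b1 (@malcev_br _ (et_alg (tw_emb charK c)) x y) =
    @malcev_br _ (et_alg (tw_emb charK d)) (shear b1 x) (shear b1 y).
  congr pair; rewrite /= -addrA omE !linearDr; zmodule.
have Frho x m : shear b0 (et_rho (tw_emb charK c) x m) =
    et_rho (tw_emb charK d) (shear b1 x) (shear b0 m).
  congr pair; rewrite /= -addrA nuE !linearDr; zmodule.
exists (@EtMorph K (tw_emb charK c) (tw_emb charK d) (shear b0) (shear b1)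
  FT Fbr Frho).
by split=> // v; congr pair; rewrite /= linear0 addr0.
Qed.
End TwistedExtension.

(** * Presentation of an extension by a cocycle *)

Section Transport.
Variables (G N G' N' : zmodType).
Variables (f1 : {additive G -> G'}) (f0 : {additive N -> N'}).
Variables (b : G -> G -> G) (r : G -> N -> N) (T : N -> G).
Variables (b' : G' -> G' -> G') (r' : G' -> N' -> N') (T' : N' -> G').
Hypothesis f1b : forall x y, f1 (b x y) = b' (f1 x) (f1 y).
Hypothesis f0r : forall x m, f0 (r x m) = r' (f1 x) (f0 m).
Hypothesis f0T : forall m, T' (f0 m) = f1 (T m).

Lemma sagle_morph x y z t :
  f1 (sagle b x y z t) = sagle b' (f1 x) (f1 y) (f1 z) (f1 t).
Proof. by rewrite /sagle raddfB !raddfD /= !f1b. Qed.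

Lemma rep_defect_morph x y z m :
  f0 (rep_defect b r x y z m) = rep_defect b' r' (f1 x) (f1 y) (f1 z) (f0 m).
Proof.
by rewrite /rep_defect !(raddfB, raddfD) /= !(f0r, f1b).
Qed.

Lemma emb_defect_morph m n :
  f1 (emb_defect b r T m n) = emb_defect b' r' T' (f0 m) (f0 n).
Proof. by rewrite /emb_defect raddfB /= f1b -!f0T f0r -f0T. Qed.

End Transport.

Section Glue.
Variables (K : fieldType) (U N V : lmodType K).
Variables (i : {linear U -> N}) (p : {linear N -> V}).
Hypothesis exact_ip : short_exact i p.

Lemma exact_i_inj : injective i. Proof. by case: exact_ip. Qed.

Lemma exact_pi u : p (i u) = 0.
Proof. by have [_ kerp _] := exact_ip; apply/kerp; exists u. Qed.

Lemma exact_ker n : p n = 0 -> exists u, i u = n.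
Proof. by have [_ kerp _] := exact_ip; move/kerp. Qed.

Definition glue (s : V -> N) (a : V * U) : N := s a.1 + i a.2.

Variable s : {linear V -> N}.

Lemma glue_linear : linear (glue s).
Proof. by move=> a x y; rewrite /glue; apply: lin_add; rewrite linearP. Qed.

HB.instance Definition _ :=
  GRing.isLinear.Build K (V * U)%type N *:%R (glue s) glue_linear.

Lemma glue_eq0 a : cancel s p -> glue s a = 0 -> a = 0.
Proof.
case: a => v u sK; rewrite /glue /= => suv0.
have v0 : v = 0.
  by have := congr1 p suv0; rewrite linearD exact_pi sK addr0 linear0.
move: suv0; rewrite v0 linear0 add0r -[RHS](linear0 i) => /exact_i_inj ->.
by [].
Qed.

End Glue.

(** The short five lemma. *)
Lemma short_exact_iso (K : fieldType) (U V N N' : lmodType K)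
    (i : {linear U -> N}) (p : {linear N -> V})
    (j : {linear U -> N'}) (q : {linear N' -> V}) (F : {linear N -> N'}) :
  short_exact i p -> short_exact j q ->
  (forall u, F (i u) = j u) -> (forall n, q (F n) = p n) ->
  exists F' : {linear N' -> N}, cancel F F' /\ cancel F' F.
Proof.
move=> ip jq Fi qF.
have Finj : injective F.
  move=> a b Fab; apply/eqP; rewrite -subr_eq0; apply/eqP.
  have F0 : F (a - b) = 0 by rewrite linearB Fab subrr.
  have [|u iu] := @exact_ker _ _ _ _ _ _ ip (a - b).
    by rewrite -qF F0 linear0.
  move: F0; rewrite -iu Fi -[RHS](linear0 j) => /(exact_i_inj jq) ->.
  by rewrite linear0.
have Fsurj n' : exists n, F n = n'.
  have [_ _ /(_ (q n'))[n pn]] := ip.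
  have [|u ju] := @exact_ker _ _ _ _ _ _ jq (n' - F n).
    by rewrite linearB qF pn subrr.
  by exists (n + i u); rewrite linearD Fi ju addrC subrK.
have [F' F'K] := choice Fsurj.
have FK : cancel F F' by move=> n; apply: Finj; rewrite F'K.
pose F'L : {linear N' -> N} :=
  HB.pack F' (GRing.isLinear.Build K N' N *:%R F' (can2_linear FK F'K)).
by exists F'L.
Qed.

Section ExtEquiv.
Variables (K : fieldType) (E A : embTensor K).
Implicit Types X Y Z : abExt E A.

Lemma ext_equiv_sym X Y : ext_equiv X Y -> ext_equiv Y X.
Proof.
move=> [F [F0i F1i F0p F1p]].
have [H0 [F0K H0K]] := short_exact_iso (ext_exact0 X) (ext_exact0 Y) F0i F0p.
have [H1 [F1K H1K]] := short_exact_iso (ext_exact1 X) (ext_exact1 Y) F1i F1p.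
have HT m : et_T (ext_tot X) (H0 m) = H1 (et_T (ext_tot Y) m).
  by apply: (can_inj F1K); rewrite H1K -mor_T H0K.
have Hbr x y : H1 (br x y) = br (H1 x) (H1 y).
  by apply: (can_inj F1K); rewrite H1K mor_br !H1K.
have Hrho x m : H0 (et_rho (ext_tot Y) x m) = et_rho (ext_tot X) (H1 x) (H0 m).
  by apply: (can_inj F0K); rewrite H0K mor_rho H0K H1K.
exists (EtMorph HT Hbr Hrho); split=> /= a.
- by rewrite -F0i F0K.
- by rewrite -F1i F1K.
- by rewrite -F0p H0K.
- by rewrite -F1p H1K.
Qed.

Lemma ext_equiv_trans X Y Z : ext_equiv X Y -> ext_equiv Y Z -> ext_equiv X Z.
Proof.
move=> [F [F0i F1i F0p F1p]] [H [H0i H1i H0p H1p]].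
have HT m : et_T (ext_tot Z) ((mor0 H \o mor0 F) m) =
    (mor1 H \o mor1 F) (et_T (ext_tot X) m) by rewrite /= !mor_T.
have Hbr x y : (mor1 H \o mor1 F) (br x y) =
    br ((mor1 H \o mor1 F) x) ((mor1 H \o mor1 F) y) by rewrite /= !mor_br.
have Hrho x m : (mor0 H \o mor0 F) (et_rho (ext_tot X) x m) =
  et_rho (ext_tot Z) ((mor1 H \o mor1 F) x) ((mor0 H \o mor0 F) m).
  by rewrite /= !mor_rho.
exists (EtMorph HT Hbr Hrho); split=> /= a.
- by rewrite F0i H0i.
- by rewrite F1i H1i.
- by rewrite H0p F0p.
- by rewrite H1p F1p.
Qed.
End ExtEquiv.

Section Presentation.
Variables (K : fieldType) (charK : [pchar K] =i pred0).
Variables (E A : embTensor K) (abA : et_abelian A) (r : etRep E A).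

(** Sections s0, s1 determine a cochain whose components measure how far
    they are from commuting with an operation of the extension.  Gluing them to
    the inclusions of the kernel gives injections f0, f1 of the twisted product
    into the extension that preserve the operations, hence the defects: those of
    the twisted product vanish, which is the cocycle condition. *)
Lemma tw_ext_presents (X : ext_over r) :
  exists c : Z2 r, ext_equiv (tw_ext charK abA c) (sval X).
Proof.
case: X => X Xr /=.
pose i0 := mor0 (ext_i X); pose i1 := mor1 (ext_i X).
pose p0 := mor0 (ext_p X); pose p1 := mor1 (ext_p X).
have ex0 : short_exact i0 p0 := ext_exact0 X.
have ex1 : short_exact i1 p1 := ext_exact1 X.
pose Tx := et_T (ext_tot X); pose rx := et_rho (ext_tot X).
pose bx := malcev_br (et_alg (ext_tot X)).
have [s0 s0K] : exists s0 : {linear et_mod E -> et_mod (ext_tot X)},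
    cancel s0 p0.
  by apply: linear_section; case: ex0.
have [s1 s1K] : exists s1 : {linear et_alg E -> et_alg (ext_tot X)},
    cancel s1 p1.
  by apply: linear_section; case: ex1.
have [rho1E rho2E rho3E] := Xr s0 s1 s0K s1K.
have [br0 _ rho0] := abA.
have /choice[th thE] : forall m, exists w, i1 w = Tx (s0 m) - s1 (et_T E m).
  move=> m; apply: (exact_ker ex1).
  by rewrite linearB s1K -mor_T s0K subrr.
have /choice[om omE] : forall a : et_alg E * et_alg E,
    exists w, i1 w = bx (s1 a.1) (s1 a.2) - s1 (br a.1 a.2).
  move=> a; apply: (exact_ker ex1).
  by rewrite linearB s1K /p1 mor_br !s1K subrr.
have /choice[nu nuE] : forall a : et_alg E * et_mod E,
    exists v, i0 v = rx (s1 a.1) (s0 a.2) - s0 (et_rho E a.1 a.2).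
  move=> a; apply: (exact_ker ex0).
  by rewrite linearB s0K /p0 mor_rho s0K s1K subrr.
pose c : cochain E A := (th, fun x y => om (x, y), fun x m => nu (x, m)).
pose f0 := glue i0 s0; pose f1 := glue i1 s1.
have f1b a b : f1 (tw_br r c a b) = bx (f1 a) (f1 b).
  case: a b => [x u] [y w]; rewrite /f1 /glue /=.
  have uw0 : bx (i1 u) (i1 w) = 0 by rewrite -mor_br br0 linear0.
  rewrite !(linearD, linearN) /= !(linearDl, linearDr) /= omE rho2E rho2E uw0.
  rewrite (malcev_skew (i1 u)); zmodule.
have f0r a n : f0 (tw_rho r c a n) = rx (f1 a) (f0 n).
  case: a n => [x u] [m v]; rewrite /f0 /f1 /glue /=.
  have uv0 : rx (i1 u) (i0 v) = 0 by rewrite -mor_rho rho0 linear0.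
  rewrite !(linearD, linearN) /= !(linearDl, linearDr) /= nuE rho1E rho3E uv0.
  zmodule.
have f0T n : Tx (f0 n) = f1 (tw_T c n).
  case: n => [m v]; rewrite /f0 /f1 /glue /= !linearD /= thE mor_T.
  zmodule.
have f0_eq0 a : f0 a = 0 -> a = 0 := glue_eq0 ex0 s0K.
have f1_eq0 a : f1 a = 0 -> a = 0 := glue_eq0 ex1 s1K.
have i0_inj := exact_i_inj ex0; have i1_inj := exact_i_inj ex1.
have cP : is_cocycle r c.
  split=> /=.
  - move=> a m n; apply: i1_inj; rewrite linearP !thE.
    by apply: lin_add; last (apply: lin_opp); rewrite !linearP.
  - split=> [y a x x'|x a y y']; apply: i1_inj; rewrite linearP !omE /=.
      by apply: lin_add; last (apply: lin_opp); rewrite !(linearP, linearPl).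
    by apply: lin_add; last (apply: lin_opp); rewrite !(linearP, linearPr).
  - move=> x; apply: i1_inj; rewrite omE linear0 /=.
    by rewrite /bx !(skew_diag charK (@malcev_skew K _)) linear0 subrr.
  - split=> [y a x x'|x a y y']; apply: i0_inj; rewrite linearP !nuE /=.
      by apply: lin_add; last (apply: lin_opp); rewrite !(linearP, linearPl).
    by apply: lin_add; last (apply: lin_opp); rewrite !(linearP, linearPr).
  - move=> m n.
    have /f1_eq0 : f1 (emb_defect (tw_br r c) (tw_rho r c) (tw_T c)
        (m, 0) (n, 0)) = 0.
      apply: etrans (emb_defect_morph f1b f0r f0T _ _) _.
      by rewrite /emb_defect et_TP subrr.
    by rewrite tw_emb_defect => /(congr1 snd).
  - move=> x y z t.
    have /f1_eq0 : f1 (sagle (tw_br r c) (x, 0) (y, 0) (z, 0) (t, 0)) = 0.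
      apply: etrans (sagle_morph f1b _ _ _ _) _.
      have [mal _] := malcev_sagle charK (@malcev_skew K (et_alg (ext_tot X))).
      by apply: mal; apply: malcev_id.
    by rewrite tw_sagle => /(congr1 snd).
  - move=> x y z m.
    have /f0_eq0 : f0 (rep_defect (tw_br r c) (tw_rho r c)
        (x, 0) (y, 0) (z, 0) (m, 0)) = 0.
      apply: etrans (rep_defect_morph f1b f0r _ _ _ _) _.
      by rewrite /rep_defect et_rhoP subrr.
    by rewrite tw_rep_defect => /(congr1 snd).
exists (MkZ2 (asboolT cP)).
exists (@EtMorph _ (tw_emb charK (MkZ2 (asboolT cP))) (ext_tot X)
  f0 f1 f0T f1b f0r).
split=> /= a; rewrite /f0 /f1 /glue /=.
- by rewrite linear0 add0r.
- by rewrite linear0 add0r.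
- by rewrite linearD s0K (exact_pi ex0) addr0.
- by rewrite linearD s1K (exact_pi ex1) addr0.
Qed.
End Presentation.

(** * The classification *)

(** A class carries only the existence of a representative, and q only that of a
    preimage; choosing both gives Phi and its inverse.  Changing the choices
    changes neither map, since R is the kernel of f. *)
Lemma classes_bijective (S Q : Type) (R : S -> S -> Prop) (f : S -> Q) :
  (forall X Y, R X Y <-> f X = f Y) -> (forall q, exists X, f X = q) ->
  exists Phi : {C : S -> Prop | exists X, C = fun Y => R X Y} -> Q,
    bijective Phi.
Proof.
move=> Rf fsurj; have [s sK] := choice fsurj.
pose classes := {C : S -> Prop | exists X, C = fun Y => R X Y}.
pose class X : classes := exist _ (R X) (ex_intro _ X erefl).
have [rep repE] := choice (fun C : classes => svalP C).
have classP C X : sval C = R X -> C = class X.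
  by case: C => C hC /= CX; apply: eq_exist.
exists (fun C => f (rep C)), (fun q => class (s q)) => [C|q].
  apply/esym/classP; rewrite repE; apply/funext => Y; apply/propext.
  by rewrite !Rf sK.
have repq : R (s q) (s q) = R (rep (class (s q))) (s q).
  by apply: (congr1 (fun C => C (s q)) (repE (class (s q)))).
have : R (s q) (s q) by apply/Rf.
by rewrite repq Rf sK.
Qed.

Theorem theorem4p4 (K : fieldType) (charK : [pchar K] =i pred0)
    (E A : embTensor K) (abA : et_abelian A) (r : etRep E A) :
  exists Phi : ext_class r -> H2 r, bijective Phi.
Proof.
have [c cP] := choice (@tw_ext_presents K charK E A abA r).
apply: (@classes_bijective _ _ _ (fun X => \pi_(H2 r)%qT (c X))) => [X Y|h].
  have cXY : ext_equiv (tw_ext charK abA (c X)) (tw_ext charK abA (c Y)) <->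
      \pi_(H2 r)%qT (c X) = \pi_(H2 r)%qT (c Y).
    rewrite tw_ext_equiv Quotient.idealrBE.
    by split=> /eqP.
  rewrite -cXY; split=> XY.
    exact: ext_equiv_trans (cP X) (ext_equiv_trans XY (ext_equiv_sym (cP Y))).
  exact: ext_equiv_trans (ext_equiv_sym (cP X)) (ext_equiv_trans XY (cP Y)).
pose X : ext_over r :=
  exist _ (tw_ext charK abA (repr h)) (@tw_ext_induces _ _ _ _ _ _ (repr h)).
exists X; rewrite -[RHS]reprK; apply/eqP; rewrite -Quotient.idealrBE.
by apply/(tw_ext_equiv charK abA); apply: cP.
Qed.
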